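(* Let $\mathfrak p$ be a uniform (unordered hypergraph) property, and let $m\ge 0$, $n\ge 1$ be integers. Then $$\alpha^\ast_{\mathfrak p}(m,n)=\sum_{\tau=(\alpha_1,\dots,\alpha_n),\ \sigma(\tau)=n}(-1)^{n-\alpha_1-\dots-\alpha_n}\,c(\tau)\,\alpha_{\mathfrak p}(m,n;\tau).$$
   Context: An unordered (labelled) $(m,n)$-hypergraph $H$ consists of a linearly ordered vertex set $V=\{V[1]<\dots<V[n]\}$ with $n\ge1$ elements together with an unordered finite family of $m$ subsets of $V$, called edges; edges may be empty and may repeat, so the family is a multiset of $m$ subsets of $V$. Two such hypergraphs are identified if the order-preserving bijection of their vertex sets carries one family of edges to the other (with multiplicities), so one counts $(m,n)$-hypergraphs on a fixed linearly ordered $n$-set. An unordered hypergraph property is a property of such hypergraphs, invariant under this identification. For vertices $u,v$ of $H$ write $u\sim_H v$ if every edge of $H$ contains either both or neither of $u,v$. $H$ is a $T_0$-hypergraph if $u\not\sim_H v$ for all distinct vertices $u,v$. $\alpha^\ast_{\mathfrak p}(m,n)$ is the number of $(m,n)$-hypergraphs that have property $\mathfrak p$ and are $T_0$-hypergraphs. For a partition $\pi$ of $\{1,\dots,n\}$, $\alpha_{\mathfrak p}(m,n;\pi)$ is the number of $(m,n)$-hypergraphs $H$ with property $\mathfrak p$ such that $V[i]\sim_H V[j]$ whenever $i,j$ lie in the same class of $\pi$. A partition type is an $n$-tuple $\tau=(\alpha_1,\dots,\alpha_n)$ of non-negative integers with $\sigma(\tau):=\alpha_1+2\alpha_2+\dots+n\alpha_n=n$.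 A partition $\pi$ of an $n$-set has type $\mathrm{typ}(\pi)=\tau$ if it has exactly $\alpha_i$ classes of cardinality $i$ for every $i$. The property $\mathfrak p$ is uniform if $\mathrm{typ}(\pi)=\mathrm{typ}(\pi')=\tau$ always implies $\alpha_{\mathfrak p}(m,n;\pi)=\alpha_{\mathfrak p}(m,n;\pi')$; the common value is denoted $\alpha_{\mathfrak p}(m,n;\tau)$. Finally $$c(\tau)=\frac{n!}{\alpha_1!\,\alpha_2!\cdots\alpha_n!\,2^{\alpha_2}\cdots n^{\alpha_n}}.$$ *)

(* Defs.v *)
From HB Require Import structures.
From mathcomp Require Import all_boot all_order all_algebra.

Set Implicit Arguments.
Unset Strict Implicit.
Unset Printing Implicit Defensive.

Import GRing.Theory Num.Theory.

(* The vertex set is 'I_n with its usual order (vertex V[i+1] is i : 'I_n);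
   since every order-preserving bijection of 'I_n is the identity, hypergraphs
   on 'I_n are exactly the identification classes of (m, n)-hypergraphs.
   The multiset of edges is given by its multiplicity function; a multiplicity
   cannot exceed the total number m of edges, so the codomain 'I_m.+1 is no
   restriction and makes the type finite. *)
Record hypergraph (m n : nat) := Hypergraph {
  mult :> {ffun {set 'I_n} -> 'I_m.+1};
  _ : (\sum_(e : {set 'I_n}) mult e)%N == m
}.

HB.instance Definition _ (m n : nat) := [isSub for @mult m n].
HB.instance Definition _ (m n : nat) := [Finite of hypergraph m n by <:].

Definition is_edge (m n : nat) (H : hypergraph m n) (e : {set 'I_n}) : bool :=
  (0 < H e)%N.

Definition hypergraph_property := forall m n : nat, pred (hypergraph m n).

Definition vsim (m n : nat) (H : hypergraph m n) (u v : 'I_n) : bool :=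
  [forall e : {set 'I_n}, is_edge H e ==> ((u \in e) == (v \in e))].

Definition is_T0 (m n : nat) (H : hypergraph m n) : bool :=
  [forall u : 'I_n, forall v : 'I_n, (u != v) ==> ~~ vsim H u v].

Definition alpha_star (p : hypergraph_property) (m n : nat) : nat :=
  #|[set H : hypergraph m n | p m n H & is_T0 H]|.

Definition alpha_part (p : hypergraph_property) (m n : nat)
    (P : {set {set 'I_n}}) : nat :=
  #|[set H : hypergraph m n | p m n H &
      [forall B in P, forall i in B, forall j in B, vsim H i j]]|.

(* The component alpha_i of the tuple is (tau k : nat) with i = k.+1.
   If the tuple satisfies sigma = n, then each component is at most n (see
   [sigma_bound]), so the codomain 'I_n.+1 loses no partition type. *)
Definition type_tuple (n : nat) := {ffun 'I_n -> 'I_n.+1}.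

Definition sigma (n : nat) (tau : type_tuple n) : nat :=
  (\sum_(k < n) k.+1 * tau k)%N.

Lemma sigma_bound (n : nat) (a : 'I_n -> nat) :
  (\sum_(k < n) k.+1 * a k)%N = n -> forall k, (a k < n.+1)%N.
Proof.
move=> an k; rewrite ltnS -[leqRHS]an (bigD1 k) //=.
by apply: leq_trans (leq_addr _ _); rewrite leq_pmull.
Qed.

Definition is_partition_type (n : nat) (tau : type_tuple n) : bool :=
  sigma tau == n.

Definition has_type (n : nat) (P : {set {set 'I_n}}) (tau : type_tuple n) :
    bool :=
  [forall k : 'I_n, #|[set B in P | #|B| == k.+1]| == tau k].

Definition uniform (p : hypergraph_property) : Prop :=
  forall (m n : nat) (tau : type_tuple n) (P P' : {set {set 'I_n}}),
    (0 < n)%N -> is_partition_type tau ->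
    partition P [set: 'I_n] -> partition P' [set: 'I_n] ->
    has_type P tau -> has_type P' tau ->
    alpha_part p m P = alpha_part p m P'.

(* The value at one chosen partition of type tau; for uniform p this is the
   common value (see [alpha_typeE]).  The value 0 is a junk default, as every
   partition type is the type of some partition. *)
Definition alpha_type (p : hypergraph_property) (m n : nat)
    (tau : type_tuple n) : nat :=
  if [pick P : {set {set 'I_n}} | partition P [set: 'I_n] & has_type P tau]
    is Some P then alpha_part p m P else 0%N.

Lemma alpha_typeE (p : hypergraph_property) (m n : nat) (tau : type_tuple n)
    (P : {set {set 'I_n}}) :
  uniform p -> (0 < n)%N -> is_partition_type tau ->
  partition P [set: 'I_n] -> has_type P tau ->
  alpha_type p m tau = alpha_part p m P.
Proof.
move=> pu n0 st Pp Pt; rewrite /alpha_type.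
case: pickP => [Q /andP[Qp Qt]|/(_ P)]; last by rewrite Pp Pt.
exact: (pu m n tau).
Qed.

Local Open Scope ring_scope.

Definition ccoef (n : nat) (tau : type_tuple n) : rat :=
  n`!%:R / ((\prod_(k < n) (tau k)`!) * (\prod_(k < n) k.+1 ^ tau k))%N%:R.

(* Main.v *)
(* By Cauchy's formula, [c(tau)] is the number of permutations of cycle type
   [tau], and [n - alpha_1 - ... - alpha_n] has the parity of each one.
   As [p] is uniform, the right-hand side is therefore the sum over all
   permutations [s] of [sign s] times the number of hypergraphs with property
   [p] for which each cycle of [s] lies in one class of [~_H].  Exchanging sums,
   a hypergraph [H] contributes the sum of the signs over the Young subgroup of
   the classes of [~_H], which is 1 if all classes are singletons and 0
   otherwise. *)

Require Import Defs.
From mathcomp Require Import all_boot all_order all_algebra.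
From mathcomp Require Import all_fingroup zify.
Import GRing.Theory Num.Theory.

Set Implicit Arguments.
Unset Strict Implicit.
Unset Printing Implicit Defensive.

(** * Inserting a point into a cycle of a permutation *)

Section InsertPoint.
Local Open Scope group_scope.
Variables (T : finType) (S : {set T}) (s : {perm T}) (x y : T).
Hypotheses (sS : perm_on S s) (xS : x \notin S) (yS : y \in S).
Let t := tperm x y * s.

Let sx : s x = x. Proof. exact: out_perm sS xS. Qed.

Lemma porbit_sub_perm_on z : z \in S -> porbit s z \subset S.
Proof.
move=> zS; apply/subsetP => _ /porbitP[i ->].
elim: i => [|i IH]; first by rewrite expg0 perm1.
by rewrite expgSr permM perm_closed.
Qed.

Let x_out z : z \in S -> x \notin porbit s z.
Proof. by move=> zS; apply: contra xS; apply/subsetP/porbit_sub_perm_on. Qed.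

(** Since [t] sends [y] to [x] and [x] to [s y], and otherwise agrees with [s], following [t] from
    [y] traces the [s]-cycle of [y] with [x] spliced in after [y]. *)
Lemma porbit_insert_in : porbit t y = x |: porbit s y.
Proof.
have nxy : x != y by apply: contraNneq xS => ->.
have ty : t y = x by rewrite permM tpermR.
have tx : t x = s y by rewrite permM tpermL.
have tz z : z != x -> z != y -> t z = s z.
  by move=> zx zy; rewrite permM tpermD // eq_sym.
have clos (u : {perm T}) z w : w \in porbit u z -> u w \in porbit u z.
  by rewrite -!eq_porbit_mem; have := porbit_perm u 1 w; rewrite expg1 => ->.
apply/eqP; rewrite eqEsubset; apply/andP; split.
  apply/subsetP => _ /porbitP[i ->].
  elim: i => [|i]; first by rewrite expg0 perm1 inE porbit_id orbT.
  rewrite expgSr permM; set w := (t ^+ i) y => IH.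
  have [->|wx] := eqVneq w x; first by rewrite tx inE clos ?orbT ?porbit_id.
  have [->|wy] := eqVneq w y; first by rewrite ty setU11.
  by rewrite tz // inE clos ?orbT //; move: IH; rewrite !inE (negPf wx).
have xt : x \in porbit t y by rewrite -ty clos ?porbit_id.
rewrite subUset sub1set xt /=; apply/subsetP => _ /porbitP[i ->].
elim: i => [|i]; first by rewrite expg0 perm1 porbit_id.
rewrite expgSr permM; set w := (s ^+ i) y => IH.
have [->|wx] := eqVneq w x; first by rewrite sx.
have [->|wy] := eqVneq w y; first by rewrite -tx clos.
by rewrite -tz // clos.
Qed.

Lemma porbit_insert_out z : z \in S -> z \notin porbit s y ->
  porbit t z = porbit s z.
Proof.
move=> zS zy.
have H i : (t ^+ i) z = (s ^+ i) z.
  elim: i => [|i IH]; first by rewrite !expg0.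
  rewrite !expgSr !permM IH tpermD //.
    by apply: contraNneq (x_out zS) => ->; exact: mem_porbit.
  by apply: contraNneq zy => ->; rewrite porbit_sym mem_porbit.
by apply/setP => w; apply/porbitP/porbitP => -[i ->]; exists i; rewrite H.
Qed.

Lemma porbits_insert :
  porbit t @: (x |: S) =
  (x |: porbit s y) |: ((porbit s @: S) :\ porbit s y).
Proof.
have key z : z \in porbit t y -> porbit t z = x |: porbit s y.
  by rewrite -porbit_insert_in -eq_porbit_mem => /eqP.
apply/setP => B; rewrite !inE; apply/imsetP/orP.
  case=> z; rewrite inE in_set1 => zxS ->.
  have [zt|] := boolP (z \in porbit t y); first by left; rewrite key.
  rewrite porbit_insert_in !inE negb_or => /andP[zx zy]; right.
  move: zxS; rewrite (negPf zx) /= => zS.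
  by rewrite porbit_insert_out // imset_f // andbT eq_porbit_mem.
case=> [/eqP->|/andP[ny /imsetP[z zS BE]]].
  by exists y; [rewrite !inE yS orbT | rewrite porbit_insert_in].
exists z; first by rewrite !inE zS orbT.
by rewrite BE porbit_insert_out // -eq_porbit_mem -BE.
Qed.

Lemma porbit_insert_notin : x |: porbit s y \notin porbit s @: S.
Proof.
apply/imsetP => -[z zS E]; have := x_out zS.
by rewrite -E setU11.
Qed.

Lemma porbit_fixed : porbit s x = [set x].
Proof.
apply/eqP; rewrite eqEsubset sub1set porbit_id andbT.
apply/subsetP => _ /porbitP[i ->]; rewrite inE; apply/eqP.
by elim: i => [|i IH]; rewrite ?expg0 ?perm1 // expgSr permM IH sx.
Qed.

End InsertPoint.

(* Here and below, index [k] refers to cycles of length [k.+1]. *)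
Definition ncycles (T : finType) (S : {set T}) (s : {perm T}) (k : nat) : nat :=
  \sum_(B in porbit s @: S) (#|B| == k.+1).

(** * Cycle counts after adding a point *)

Section Ncycles.
Variables (T : finType) (S : {set T}) (s : {perm T}) (x : T).
Hypotheses (sS : perm_on S s) (xS : x \notin S).

Lemma ncycles_fixed k : ncycles (x |: S) s k = (k == 0) + ncycles S s k.
Proof.
rewrite /ncycles imsetU1 big_setU1 ?(porbit_fixed sS xS) ?cards1 1?eq_sym //=.
apply/imsetP => -[z zS E]; have /subsetP := porbit_sub_perm_on sS zS.
by move=> /(_ x); rewrite -E set11 (negPf xS) => /(_ isT).
Qed.

(** One cycle of length [j.+1] becomes one of length [j.+2]; indicators on both sides avoid
    truncated subtraction. *)
Lemma ncycles_insert y j k : y \in S -> #|porbit s y| = j.+1 ->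
  ncycles (x |: S) (tperm x y * s)%g k + (k == j) =
  ncycles S s k + (k == j.+1).
Proof.
move=> yS cy; rewrite /ncycles (porbits_insert sS xS yS).
have xy : x \notin porbit s y.
  by apply: contra xS; apply/subsetP/porbit_sub_perm_on.
rewrite big_setU1 /=; last first.
  by rewrite inE negb_and (porbit_insert_notin y sS xS) orbT.
rewrite (big_setD1 (porbit s y) (imset_f _ yS)) /=.
rewrite cardsU1 xy cy add1n !eqSS !(eq_sym k); lia.
Qed.

(** Group the points by cycle. This counts the places where a new point can enter a cycle of given
    length. *)
Lemma card_porbit_eq k : #|[set y in S | #|porbit s y| == k.+1]| =
  k.+1 * ncycles S s k.
Proof.
rewrite -sum1dep_card big_mkcondr (partition_big_imset (porbit s)) /=.
rewrite big_distrr; apply: eq_bigr => _ /imsetP[z zS ->] /=.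
under eq_bigr => y /andP[_ /eqP ->] do
  rewrite -[if _ then _ else _]/(nat_of_bool _).
rewrite sum_nat_cond_const; case: eqP => [E|_]; last by rewrite !muln0.
rewrite !muln1 -E; apply: eq_card => w; rewrite !inE eq_porbit_mem.
case: (boolP (w \in porbit s z)) => wz; last by rewrite andbF.
by rewrite (subsetP (porbit_sub_perm_on sS zS) _ wz).
Qed.

End Ncycles.

(** Each [t] factors uniquely as [tperm x y * s], where [y] is the preimage of [x] under [t] and [s]
    fixes [x]; the case [y = x] gives the term [F s]. *)
Lemma big_perm_onU1 (T : finType) (S : {set T}) (x : T) (F : {perm T} -> nat) :
  x \notin S ->
  (\sum_(t | perm_on (x |: S) t) F t =
   \sum_(s | perm_on S s) (F s + \sum_(y in S) F (tperm x y * s)%g))%N.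
Proof.
move=> xS.
have Es s : (F s + \sum_(y in S) F (tperm x y * s)%g =
             \sum_(y in x |: S) F (tperm x y * s)%g)%N.
  by rewrite big_setU1 //= tperm1 mul1g.
under [RHS]eq_bigr => s _ do rewrite Es.
rewrite pair_big /=.
pose h (u : {perm T} * T) := (tperm x u.2 * u.1)%g.
pose h' (t : {perm T}) := (tperm x ((t^-1)%g x) * t, (t^-1)%g x)%g.
rewrite (reindex_onto h h') => [|t _]; last first.
  by rewrite /h /h' /= mulgA tperm2 mul1g.
apply: eq_bigl => -[s y]; rewrite /h /h' /=.
set t := (tperm x y * s)%g.
have tpS : y \in x |: S -> perm_on (x |: S) (tperm x y).
  move=> yS; apply: subset_trans (tperm_on x y) _.
  by rewrite subUset !sub1set yS setU11.
have sE : (tperm x y * t)%g = s by rewrite mulgA tperm2 mul1g.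
apply/andP/andP => [[pt /eqP [_ yE]]|[ps yS]].
  have ty : t y = x by rewrite -yE permKV.
  have yS : y \in x |: S by rewrite -(perm_closed y pt) ty setU11.
  split=> //; have := perm_onM (tpS yS) pt; rewrite sE => ps.
  have sx : s x = x by rewrite -sE permM tpermL.
  apply/subsetP => z; rewrite inE => sz.
  have := subsetP ps z; rewrite !inE => /(_ sz).
  by have [zx|//] := eqVneq z x; rewrite zx sx eqxx in sz.
have sVx : (t^-1)%g x = y.
  by rewrite invMg tpermV permM (out_perm (perm_onV ps) xS) tpermL.
rewrite sVx sE eqxx perm_onM ?tpS //.
by apply: subset_trans ps _; rewrite subsetUr.
Qed.

(** * Cauchy's formula by induction on the support *)

(** The order of the centralizer of a permutation with [a k] cycles of length [k.+1]. *)
Definition cauchy_denom (N : nat) (a : nat -> nat) : nat :=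
  \prod_(k < N) ((a k)`! * k.+1 ^ a k).

(** The index range depends on [T] rather than [S], so it stays fixed while [S] shrinks in the
    induction. *)
Definition nperms (T : finType) (S : {set T}) (a : nat -> nat) : nat :=
  \sum_(s : {perm T} | perm_on S s) [forall k : 'I_#|T|, ncycles S s k == a k].

Lemma eq_cauchy_denom N a b : (forall k, k < N -> a k = b k) ->
  cauchy_denom N a = cauchy_denom N b.
Proof. by move=> ab; apply: eq_bigr => k _; rewrite ab. Qed.

Lemma cauchy_denomS N a j : j < N ->
  cauchy_denom N (fun k => a k + (k == j)) =
  cauchy_denom N a * ((a j).+1 * j.+1).
Proof.
move=> jN; rewrite /cauchy_denom (bigD1 (Ordinal jN)) //.
rewrite [in RHS](bigD1 (Ordinal jN)) //= eqxx addn1 factS expnS.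
rewrite [RHS]mulnAC; congr (_ * _); first lia.
by apply: eq_bigr => k; rewrite -val_eqE /= => /negPf ->; rewrite addn0.
Qed.

(* The type obtained from [a] by replacing a cycle of length [j.+2] by one of
   length [j.+1]. *)
Definition shrink (a : nat -> nat) (j k : nat) : nat :=
  a k + (k == j) - (k == j.+1).

(** Both types arise from a common type [b] by adding one cycle, so two uses of [cauchy_denomS]
    compare them. *)
Lemma cauchy_denom_shrink N a j : j.+1 < N -> 0 < a j.+1 ->
  cauchy_denom N (shrink a j) * (j.+2 * a j.+1) =
  cauchy_denom N a * (j.+1 * (a j).+1).
Proof.
move=> jN aj; pose b k := a k - (k == j.+1).
rewrite (@eq_cauchy_denom N (shrink a j) (fun k => b k + (k == j))); last first.
  by move=> k _; rewrite /b /shrink; case: (k =P j.+1) => [->|_]; lia.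
rewrite (@eq_cauchy_denom N a (fun k => b k + (k == j.+1))); last first.
  by move=> k _; rewrite /b; case: (k =P j.+1) => [->|_]; lia.
rewrite (cauchy_denomS b (ltnW jN)) (cauchy_denomS b jN) /b eqxx.
by rewrite (ltn_eqF (ltnSn j)) subn0 subn1 (prednK aj); lia.
Qed.

Lemma sum_muln_eq N i : i < N -> \sum_(k < N) k.+1 * (k == i :> nat) = i.+1.
Proof.
move=> iN; rewrite (bigD1 (Ordinal iN)) //= eqxx muln1 big1 ?addn0 // => k.
by rewrite -val_eqE /= => /negPf ->; rewrite muln0.
Qed.

Lemma sum_shrink N a j : j.+1 < N -> 0 < a j.+1 ->
  (\sum_(k < N) k.+1 * shrink a j k).+1 = \sum_(k < N) k.+1 * a k.
Proof.
move=> jN aj.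
apply: (@addIn j.+1); rewrite addSnnS.
rewrite -{1}(sum_muln_eq jN) -{2}(sum_muln_eq (ltnW jN)).
rewrite -!big_split; apply: eq_bigr => k _ /=; rewrite -!mulnDr /shrink.
by case: ((k : nat) =P j.+1) => [->|_]; congr (_ * _); lia.
Qed.

(* Inserting [x] just before the image of a point of a cycle lengthens that
   cycle by one, and every permutation of [x |: S] that moves [x] arises once
   in this way. *)
Lemma nperms_insert (T : finType) (S : {set T}) (x : T) (a : nat -> nat) :
  x \notin S ->
  nperms (x |: S) a = (0 < a 0) * nperms S (fun k => a k - (k == 0)) +
    \sum_(j < #|T|.-1)
      (0 < a j.+1) * (j.+1 * (a j).+1) * nperms S (shrink a j).
Proof.
move=> xS.
have ST : #|S| < #|T|.
  by have := max_card (x |: S); rewrite cardsU1 xS add1n.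
rewrite /nperms big_perm_onU1 // big_split /=; congr (_ + _).
  rewrite big_distrr; apply: eq_bigr => s sS /=.
  rewrite mulnb; congr nat_of_bool.
  apply/forallP/andP => [E|[a0 /forallP E] k].
    split.
      have /eqP <- := E (Ordinal (leq_trans (ltn0Sn _) ST)).
      by rewrite ncycles_fixed.
    by apply/forallP => k; rewrite -(eqP (E k)) ncycles_fixed // addKn.
  rewrite ncycles_fixed // (eqP (E k)).
  by case: ((k : nat) =P 0) => [->|_]; lia.
under [RHS]eq_bigr do rewrite big_distrr.
rewrite [RHS]exchange_big; apply: eq_bigr => s sS /=.
have ltT y : y \in S -> #|porbit s y|.-1 < #|T|.-1.
  move=> yS; have := subset_leq_card (porbit_sub_perm_on sS yS).
  by have := card_porbit_neq0 s y; lia.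
(* If the bound is 0 then [S] is empty; otherwise [inord] below is available. *)
case Tn: #|T|.-1 ltT => [|N] ltT.
  rewrite big_ord0 big1 // => y /ltT; lia.
rewrite (partition_big (fun y => inord #|porbit s y|.-1 : 'I_N.+1) predT) //=.
apply: eq_bigr => j _.
pose g := [forall k : 'I_#|T|, ncycles S s k == shrink a j k].
(* For [y] in a cycle of length [j.+1] the condition does not depend on [y]: it says that [a j.+1]
   is positive and [s] has type [shrink a j]. *)
rewrite (eq_bigr (fun=> ((0 < a j.+1) && g : nat))) => [|y /andP[yS /eqP yj]].
  rewrite sum_nat_cond_const -/g.
  have [aj|_] := ltnP 0 (a j.+1); last by rewrite muln0.
  have [/forallP E|_] := boolP g; last by rewrite !muln0.
  (* Such an [s] has [(a j).+1] cycles of length [j.+1], which gives the number of choices of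
     [y]. *)
  have jT : j < #|T| by have := ltn_ord j; lia.
  have := E (Ordinal jT); rewrite /= /shrink eqxx (ltn_eqF (ltnSn j)).
  rewrite subn0 addn1 => /eqP <-; rewrite mul1n !muln1 -card_porbit_eq //.
  apply: eq_card => y; rewrite !inE; case: (boolP (y \in S)) => //= yS.
  by rewrite -val_eqE /= inordK ?ltT //; have := card_porbit_neq0 s y; lia.
have {yj} cy : #|porbit s y| = j.+1.
  rewrite -yj inordK ?ltT //; have := card_porbit_neq0 s y; lia.
congr nat_of_bool; have H k := ncycles_insert sS xS k yS cy.
apply/forallP/andP => [E|[aj /forallP E] k].
  have jT : j.+1 < #|T| by have := ltn_ord j; lia.
  split; first by have := H j.+1; rewrite (eqP (E (Ordinal jT))) /=; lia.
  by apply/forallP => k; rewrite /shrink -(eqP (E k)) H addnK.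
have := H k; rewrite (eqP (E k)) /shrink.
case: ((k : nat) =P j.+1) => [->|_]; first lia.
by rewrite subn0 addn0 => /addIn ->.
Qed.

(* Cauchy's formula for the size of a conjugacy class of permutations. *)
Lemma nperms_cauchy (T : finType) (S : {set T}) (a : nat -> nat) :
  \sum_(k < #|T|) k.+1 * a k = #|S| ->
  nperms S a * cauchy_denom #|T| a = #|S|`!.
Proof.
(* Strong induction on [#|S|], for all [a] at once, as the recursion changes the type. *)
elim: {S}_.+1 {-2}S (ltnSn #|S|) a => // m IH S; rewrite ltnS => Sm a sa.
have [S0|[x xS]] := set_0Vmem S.
  have a0 (k : 'I_#|T|) : a k = 0.
    move/eqP: sa; rewrite S0 cards0 sum_nat_eq0 => /forallP/(_ k)/=.
    by rewrite muln_eq0 => /eqP.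
  rewrite S0 cards0 /cauchy_denom big1 => [|k _]; last by rewrite a0.
  rewrite muln1 /nperms (big_pred1 1%g) => [|s]; last first.
    apply/idP/eqP => [s0|->]; last exact: perm_on1.
    by apply: (perm_on_id s0); rewrite cards0.
  rewrite (_ : [forall _, _]) //; apply/forallP => k.
  by rewrite a0 /ncycles imset0 big_set0.
have cS := cardsD1 x S; rewrite xS add1n in cS.
have xS' : x \notin S :\ x by rewrite !inE eqxx.
have {}IH (b : nat -> nat) (eb : (\sum_(k < #|T|) k.+1 * b k).+1 = #|S|) :
    nperms (S :\ x) b * cauchy_denom #|T| b = #|S :\ x|`!.
  by apply: IH; [rewrite -cS | apply: succn_inj; rewrite -cS].
have [n Tn] : exists n, #|T| = n.+1.
  by case: #|T| (max_card S) cS => [|n _ _]; [case: #|S| | exists n].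
(* Expand the leading factor [#|S|] of the factorial as the weighted sum of [a], then match it
   termwise with the recursion: fixed points give the term [k = 0], and insertion into cycles of
   length [j.+1] gives the term [k = j.+1]. *)
rewrite -(setD1K xS) nperms_insert // (setD1K xS) cS factS -cS -sa mulnDl.
rewrite big_distrl /= Tn big_ord_recl mul1n /= [RHS]mulnDl -Tn; congr (_ + _).
  have [->//|a0] := posnP (a 0); pose b k := a k - (k == 0).
  have ab k : a k = b k + (k == 0) by rewrite /b; case: k => [|k] /=; lia.
  have T0 : 0 < #|T| by rewrite Tn.
  rewrite -(IH b); last first.
    rewrite -sa -addn1 -[X in _ + X](sum_muln_eq T0) -big_split /=.
    by apply: eq_bigr => k _; rewrite -mulnDr -ab.
  have b0 : (b 0).+1 = a 0 by rewrite ab addn1.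
  rewrite (eq_cauchy_denom (fun k _ => ab k)) cauchy_denomS // b0.
  by rewrite muln1 mulnA [LHS]mulnC mul1n.
rewrite big_distrl; apply: eq_bigr => j _ /=; rewrite /bump add1n.
have [->|aj] := posnP (a j.+1); first by rewrite muln0.
have jT : j.+1 < #|T| by rewrite Tn ltnS.
have := cauchy_denom_shrink jT aj; rewrite -(IH (shrink a j)) ?sum_shrink //.
rewrite mul1n => E; rewrite mulnAC mulnC [_ * cauchy_denom _ _]mulnC -E; lia.
Qed.

(** * Cycle partitions and partition types *)

Lemma porbits_partition (T : finType) (s : {perm T}) :
  partition (porbits s) [set: T].
Proof.
apply/and3P; split.
- rewrite eqEsubset subsetT; apply/subsetP => z _; apply/bigcupP.
  by exists (porbit s z); rewrite ?imset_f ?porbit_id.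
- apply/trivIsetP => _ _ /imsetP[y _ ->] /imsetP[z _ ->]; apply: contraR.
  case/pred0Pn => w /andP[/=]; rewrite -!eq_porbit_mem.
  by move=> /eqP <- /eqP ->.
- by apply/imsetP => -[z _ E]; have := porbit_id s z; rewrite -E inE.
Qed.

Section TypeOfPartition.
Variables (n : nat) (P : {set {set 'I_n}}).
Hypothesis Ppart : partition P [set: 'I_n].

(** Classes are nonempty, so their sizes run from 1 to [n]. Taking [f] the identity yields [sigma],
    and [f] constantly 1 the number of classes. *)
Lemma sum_partition_card (f : nat -> nat) :
  \sum_(B in P) f #|B| =
  \sum_(k < n) f k.+1 * #|[set B in P | #|B| == k.+1]|.
Proof.
have [_ _ n0] := and3P Ppart.
have -> : \sum_(k < n) f k.+1 * #|[set B in P | #|B| == k.+1]| =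
    \sum_(k < n) \sum_(B in P) f k.+1 * (#|B| == k.+1).
  apply: eq_bigr => k _; rewrite -sum1dep_card big_mkcondr big_distrr /=.
  by apply: eq_bigr => B _; case: eqP.
rewrite exchange_big; apply: eq_bigr => B BP /=.
have B0 : 0 < #|B| by rewrite card_gt0; apply: contraNneq n0 => <-.
have Bn : #|B|.-1 < n by rewrite prednK // -[leqRHS]card_ord max_card.
rewrite (bigD1 (Ordinal Bn)) //= prednK // eqxx muln1 big1 ?addn0 // => k.
rewrite -val_eqE /= => kB; case: eqP => [E|_]; last by rewrite muln0.
by rewrite E eqxx in kB.
Qed.

Lemma sigma_has_type (tau : type_tuple n) : has_type P tau -> sigma tau = n.
Proof.
move=> /forallP Pt; rewrite -[RHS]card_ord -cardsT (card_partition Ppart).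
by rewrite (sum_partition_card id); apply: eq_bigr => k _; rewrite (eqP (Pt k)).
Qed.

Lemma card_has_type (tau : type_tuple n) :
  has_type P tau -> #|P| = \sum_(k < n) tau k.
Proof.
move=> /forallP Pt; rewrite -sum1_card (sum_partition_card (fun=> 1)).
by apply: eq_bigr => k _; rewrite (eqP (Pt k)) mul1n.
Qed.

(** The class counts form the type; [sigma_bound] ensures that [inord] preserves them. *)
Lemma has_typeE : exists tau : type_tuple n, has_type P =1 pred1 tau.
Proof.
pose a (k : 'I_n) := #|[set B in P | #|B| == k.+1]|.
have sa : \sum_(k < n) k.+1 * a k = n.
  by rewrite -(sum_partition_card id) -(card_partition Ppart) cardsT card_ord.
exists [ffun k => inord (a k)] => tau /=; apply/forallP/eqP => [Pt|-> k].
  by apply/ffunP => k; rewrite ffunE /a (eqP (Pt k)) inord_val.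
by rewrite ffunE inordK ?(sigma_bound sa).
Qed.

End TypeOfPartition.

Lemma card_perm_has_type (n : nat) (tau : type_tuple n) :
  is_partition_type tau ->
  #|[set s : 'S_n | has_type (porbits s) tau]| *
    (\prod_(k < n) (tau k)`! * \prod_(k < n) k.+1 ^ tau k) = n`!.
Proof.
(* [tau] extended by 0 to all of [nat]. *)
pose a k := oapp (fun i : 'I_n => tau i : nat) 0 (insub k).
have aE (k : 'I_n) : a k = tau k by rewrite /a valK.
move/eqP => st; have := @nperms_cauchy 'I_n [set: 'I_n] a.
rewrite cardsT card_ord => <-; last first.
  by rewrite -[RHS]st; apply: eq_bigr => k _; rewrite aE.
rewrite -big_split /=; congr (_ * _); last first.
  by apply: eq_bigr => k _; rewrite aE.
rewrite -sum1dep_card big_mkcond /nperms.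
apply: eq_big => [s|s _]; first by apply/esym/subsetP => z _; rewrite inE.
rewrite -[if _ then _ else _]/(nat_of_bool _); congr nat_of_bool.
have ncE k : ncycles [set: 'I_n] s k = #|[set B in porbits s | #|B| == k.+1]|.
  rewrite -sum1dep_card big_mkcondr /ncycles; apply: eq_bigl => B.
  by apply/imsetP/imsetP => -[x _ ->]; exists x.
apply/forallP/forallP => H k.
  by have := H (cast_ord (card_ord n) k); rewrite ncE -aE.
by have := H (cast_ord (esym (card_ord n)) k); rewrite ncE aE.
Qed.

(** * Permutations moving vertices only within classes of [vsim] *)

Section Vsim.
Variables (m n : nat) (H : hypergraph m n).

Lemma vsim_refl : reflexive (vsim H).
Proof. by move=> x; apply/forallP => e; rewrite eqxx implybT. Qed.

Lemma vsim_sym : symmetric (vsim H).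
Proof. by move=> x y; apply: eq_forallb => e; rewrite eq_sym. Qed.

Lemma vsim_trans : transitive (vsim H).
Proof.
move=> y x z /forallP xy /forallP yz; apply/forallP => e; apply/implyP => He.
by move: (implyP (xy e) He) (implyP (yz e) He) => /eqP -> /eqP ->.
Qed.

End Vsim.

(* For [u <> v] in one class, composing with the transposition of [u] and [v]
   pairs off the permutations preserving the classes with opposite signs. *)
Lemma sum_sign_vsim (m n : nat) (H : hypergraph m n) :
  (\sum_(s : 'S_n | [forall i, vsim H i (s i)]) (-1) ^+ s =
   (is_T0 H)%:R :> rat)%R.
Proof.
have [T0|] := boolP (is_T0 H).
  rewrite (big_pred1 1%g) ?odd_perm1 // => s.
  apply/forallP/eqP => [Hs|-> i]; last first.
    by rewrite perm1 vsim_refl.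
  apply/permP => i; rewrite perm1; apply/eqP; rewrite eq_sym.
  move/forallP/(_ i)/forallP/(_ (s i))/implyP: T0 => T0.
  by apply: contraTT (Hs i).
case/forallPn => u /forallPn[v]; rewrite negb_imply negbK => /andP[uv Huv].
have simt i : vsim H i (tperm u v i).
  case: tpermP => [->|->|_ _] //; first by rewrite vsim_sym.
  exact: vsim_refl.
set S := (\sum_(s | _) _)%R; suff: S = (- S)%R.
  by move/eqP; rewrite eq_sym eqNr => /eqP.
rewrite {1}/S (reindex_inj (mulgI (tperm u v))) -sumrN; apply: eq_big => s.
  apply/forallP/forallP => Hs i.
    by have := Hs (tperm u v i); rewrite permM tpermK; apply: vsim_trans.
  by rewrite permM; apply: vsim_trans (simt i) (Hs _).
by rewrite odd_permM odd_tperm uv signr_addb mulN1r.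
Qed.

(** By transitivity along a cycle, relating each [i] to [s i] is enough; this is the condition
    summed over in [sum_sign_vsim]. *)
Lemma alpha_part_porbits (p : hypergraph_property) (m n : nat) (s : 'S_n) :
  alpha_part p m (porbits s) =
  #|[set H : hypergraph m n | p m n H & [forall i, vsim H i (s i)]]|.
Proof.
apply: eq_card => H; rewrite !inE; congr (_ && _).
apply/forall_inP/forallP => [Hs i | Hs _ /imsetP[x _ ->]].
  have /forall_inP/(_ i) := Hs _ (imset_f (porbit s) (erefl : i \in predT)).
  rewrite porbit_id => /(_ isT)/forall_inP; apply.
  by have := mem_porbit s 1 i; rewrite expg1.
apply/forall_inP => i; rewrite -eq_porbit_mem => /eqP ix.
apply/forall_inP => j; rewrite -ix => /porbitP[k ->].
elim: k => [|k IH]; first by rewrite expg0 perm1 vsim_refl.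
by rewrite expgSr permM; apply: vsim_trans IH (Hs _).
Qed.

(** * From types to permutations to hypergraphs *)

Local Open Scope ring_scope.

Theorem theorem3p2 (p : hypergraph_property) (hp : uniform p)
  (m n : nat) (hn : (0 < n)%N) :
  (alpha_star p m n)%:R =
  \sum_(tau : type_tuple n | is_partition_type tau)
    (-1) ^+ (n - \sum_(k < n) tau k)%N * ccoef tau * (alpha_type p m tau)%:R
  :> rat.
Proof.
have ccoefE (tau : type_tuple n) : is_partition_type tau ->
    ccoef tau = #|[set s : 'S_n | has_type (porbits s) tau]|%:R.
  move=> st; rewrite /ccoef -(card_perm_has_type st) natrM mulfK //.
  rewrite pnatr_eq0 -lt0n muln_gt0 !prodn_gt0 // => k; last by rewrite fact_gt0.
  by rewrite expn_gt0.
have termE (tau : type_tuple n) : is_partition_type tau ->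
    (-1) ^+ (n - \sum_(k < n) tau k)%N * ccoef tau * (alpha_type p m tau)%:R =
    \sum_(s : 'S_n | has_type (porbits s) tau)
      (-1) ^+ s * (alpha_part p m (porbits s))%:R :> rat.
  move=> st; rewrite ccoefE // -sum1dep_card natr_sum mulr_sumr mulr_suml.
  apply: eq_bigr => s ss; have sp := porbits_partition s.
  rewrite (alpha_typeE m hp hn st sp ss) mulr1; congr (_ * _).
  have sn : (#|porbits s| <= n)%N.
    by rewrite -[leqRHS]card_ord leq_imset_card.
  (* The sign of [s] is the parity of [n] minus the number of its cycles. *)
  rewrite -(card_has_type sp ss) -signr_odd oddB //.
  by rewrite /odd_perm card_ord.
(* With permutations outermost, the inner sum over types reduces to the single type of [s], as
   checked at the end. *)
rewrite (eq_bigr _ termE) (exchange_big_dep predT) //=.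
rewrite (eq_bigr (fun s : 'S_n => (-1) ^+ s * (alpha_part p m (porbits s))%:R)).
  under eq_bigr => s _ do
    rewrite alpha_part_porbits -sum1dep_card natr_sum mulr_sumr.
  (* With hypergraphs outermost, the inner sum is the signed sum that detects [is_T0]. *)
  rewrite (exchange_big_dep (p m n)) => [|s H _ /andP[]] //=.
  rewrite /alpha_star -sum1dep_card natr_sum big_mkcondr.
  apply: eq_bigr => H pH; under eq_bigl do rewrite pH /=.
  under eq_bigr do rewrite mulr1.
  by rewrite sum_sign_vsim; case: is_T0.
move=> s _; have sp := porbits_partition s.
have [tau tauE] := has_typeE sp.
rewrite (big_pred1 tau) // => tau' /=; rewrite tauE /=.
case: eqP => [->|]; last by rewrite andbF.
by rewrite /is_partition_type (sigma_has_type sp) ?eqxx // tauE /= eqxx.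
Qed.
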